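(* Let $x_0,\dots,x_m\in\mathbb{C}^n$ be such that $x_0,\dots,x_{m-1}$ are linearly independent, and let $X=[x_0\ \cdots\ x_{m-1}]$. Let DMD eigenvalues $\lambda_1,\dots,\lambda_m$, DMD amplitudes $a_1,\dots,a_m$ and DMD modes $\vartheta_1,\dots,\vartheta_m$ be given by SVD-Dynamic Mode Decomposition (SDMD) applied to $x_0,\dots,x_m$. If the DMD eigenvalues are distinct, then $$x_k=\sum_{j=1}^m\lambda_j^ka_j\vartheta_j\quad(k=0,\dots,m-1),\qquad x_m=\sum_{j=1}^m\lambda_j^ma_j\vartheta_j+q,$$ where $q=x_m-Xc$ with $c=X^+x_m$.
   Context: $M^+$ denotes the Moore-Penrose pseudoinverse and $M^*$ the conjugate transpose of a matrix $M$. The convention $0^0=1$ is used. SDMD applied to data $x_0,\dots,x_m\in\mathbb{C}^n$: with $X=[x_0\ \cdots\ x_{m-1}]$, $Y=[x_1\ \cdots\ x_m]\in\mathbb{C}^{n\times m}$ and $r=\operatorname{rank}(X)$, take a reduced singular value decomposition $X=U\Sigma V^*$ ($U\in\mathbb{C}^{n\times r}$ and $V\in\mathbb{C}^{m\times r}$ with orthonormal columns, $\Sigma\in\mathbb{R}^{r\times r}$ diagonal with positive diagonal entries). The DMD matrix is $S=U^*YV\Sigma^{-1}\in\mathbb{C}^{r\times r}$. The DMD eigenvalues are the eigenvalues $\lambda_1,\dots,\lambda_r$ of $S$, with chosen eigenvectors $v_i$ ($Sv_i=\lambda_iv_i$, $v_i\neq0$). The DMD modes are $\vartheta_i=Uv_i\in\mathbb{C}^n$;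 put $\Theta=[\vartheta_1\ \cdots\ \vartheta_r]$. The DMD amplitudes are the entries of $a=(a_1,\dots,a_r)^T=\Theta^+x_0$. When $x_0,\dots,x_{m-1}$ are linearly independent, $r=m$. *)

(* Defs.v *)
From mathcomp Require Import all_boot all_order all_algebra.
From mathcomp Require Export spectral.
From mathcomp Require Export complex reals.

Set Implicit Arguments.
Unset Strict Implicit.
Unset Printing Implicit Defensive.

Import Order.TTheory GRing.Theory Num.Theory.
Local Open Scope ring_scope.
Local Open Scope sesquilinear_scope.

Section MoorePenrose.
Variable C : numClosedFieldType.

Definition penrose m n (A : 'M[C]_(m, n)) : pred 'M[C]_(n, m) := fun P =>
  [&& A *m P *m A == A, P *m A *m P == P,
      (A *m P)^t* == A *m P & (P *m A)^t* == P *m A].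

Lemma trmxC_mul m n p (A : 'M[C]_(m, n)) (B : 'M[C]_(n, p)) :
  (A *m B)^t* = B^t* *m A^t*.
Proof. by rewrite trmx_mul map_mxM. Qed.

Lemma gram_eq0 m n (A : 'M[C]_(m, n)) : (A *m A^t* == 0) = (A == 0).
Proof.
apply/eqP/eqP => [A0 | ->]; last by rewrite mul0mx.
apply/matrixP => i j; rewrite mxE; apply/eqP; rewrite -normr_eq0.
have /eqP : (A *m A^t*) i i = 0 by rewrite A0 mxE.
rewrite mxE psumr_eq0 => [/allP/(_ j (mem_index_enum _))|k _] /=; last first.
  by rewrite !mxE -normCK exprn_ge0.
by rewrite !mxE -normCK expf_eq0.
Qed.

Lemma gram_unit m n (A : 'M[C]_(m, n)) : row_free A -> A *m A^t* \in unitmx.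
Proof.
move=> fA; rewrite -row_free_unit -kermx_eq0.
set K := kermx _; have : K *m A *m (K *m A)^t* == 0.
  by rewrite trmxC_mul mulmxA -(mulmxA K) mulmx_ker mul0mx.
by rewrite gram_eq0 mulmx_free_eq0.
Qed.

Lemma penrose_exists m n (A : 'M[C]_(m, n)) : exists P, penrose A P.
Proof.
have := mulmx_base A; have := row_base_free A; have := col_base_full A.
move: (\rank A) (col_base A) (row_base A) => r L B fL fB <- {A}.
have uB : B *m B^t* \in unitmx by rewrite gram_unit.
have uL : L^t* *m L \in unitmx.
  by rewrite -{2}[L]trmxCK gram_unit // /row_free mxrank_map mxrank_tr.
pose G := invmx (B *m B^t*); pose H := invmx (L^t* *m L).
have GC : G^t* = G.
  by rewrite /G trmx_inv map_invmx trmxC_mul trmxCK.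
have HC : H^t* = H.
  by rewrite /H trmx_inv map_invmx trmxC_mul trmxCK.
pose K := B^t* *m G; pose J := H *m L^t*.
have BK : B *m K = 1%:M by rewrite mulmxA mulmxV.
have JL : J *m L = 1%:M by rewrite -mulmxA mulVmx.
have AP : L *m B *m (K *m J) = L *m J by rewrite -mulmxA (mulmxA B) BK mul1mx.
have PA : K *m J *m (L *m B) = K *m B by rewrite -mulmxA (mulmxA J) JL mul1mx.
exists (K *m J); apply/and4P; split; apply/eqP.
- by rewrite AP -mulmxA (mulmxA J) JL mul1mx.
- by rewrite PA -mulmxA (mulmxA B) BK mul1mx.
- by rewrite AP /J !trmxC_mul trmxCK HC mulmxA.
- by rewrite PA /K !trmxC_mul trmxCK GC mulmxA.
Qed.

Lemma penrose_unique m n (A : 'M[C]_(m, n)) P Q :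
  penrose A P -> penrose A Q -> P = Q.
Proof.
move=> /and4P[/eqP p1 /eqP p2 /eqP p3 /eqP p4].
move=> /and4P[/eqP q1 /eqP q2 /eqP q3 /eqP q4].
have eAP : A *m P = A *m Q.
  have: (A *m Q *m (A *m P))^t* = (A *m P)^t* by rewrite mulmxA q1.
  by rewrite trmxC_mul p3 q3 mulmxA p1.
have ePA : P *m A = Q *m A.
  have: (P *m A *m (Q *m A))^t* = (P *m A)^t* by rewrite -mulmxA (mulmxA A) q1.
  by rewrite trmxC_mul p4 q4 -mulmxA (mulmxA A) p1.
by rewrite -p2 -mulmxA eAP mulmxA ePA q2.
Qed.

(* The Moore-Penrose pseudoinverse. *)
Definition pinv m n (A : 'M[C]_(m, n)) : 'M[C]_(n, m) :=
  xchoose (penrose_exists A).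

Lemma pinvP m n (A : 'M[C]_(m, n)) : penrose A (pinv A).
Proof. exact: xchooseP. Qed.

End MoorePenrose.

Section SDMD.
Variable C : numClosedFieldType.

(* [0 < z] in [C] entails that [z] is real. *)
Definition reduced_svd n m r (X : 'M[C]_(n, m))
    (U : 'M[C]_(n, r)) (Sigma : 'M[C]_r) (V : 'M[C]_(m, r)) : Prop :=
  [/\ U^t* *m U = 1%:M, V^t* *m V = 1%:M,
      is_diag_mx Sigma, (forall i, 0 < Sigma i i)
    & X = U *m Sigma *m V^t*].

Section Snapshots.
Variables (n m : nat) (x : 'I_m.+1 -> 'cV[C]_n).

Definition snap (k : 'I_m) : 'cV[C]_n := x (widen_ord (leqnSn m) k).

Definition dataX : 'M[C]_(n, m) := \matrix_(i, k) snap k i 0.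

Definition dataY : 'M[C]_(n, m) := \matrix_(i, k) x (lift ord0 k) i 0.

End Snapshots.

Definition dmd_matrix n m r (Y : 'M[C]_(n, m)) (U : 'M[C]_(n, r))
    (Sigma : 'M[C]_r) (V : 'M[C]_(m, r)) : 'M[C]_r :=
  U^t* *m Y *m V *m invmx Sigma.

Definition modes_mx n r (theta : 'I_r -> 'cV[C]_n) : 'M[C]_(n, r) :=
  \matrix_(i, j) theta j i 0.

(* The reduced SVD and the eigenvectors are choices, so SDMD is a relation
   between the data and the triples (eigenvalues, amplitudes, modes); the
   eigenvalues are listed with algebraic multiplicity. *)
Definition sdmd n m r (x : 'I_m.+1 -> 'cV[C]_n)
    (lam : 'I_r -> C) (a : 'I_r -> C) (theta : 'I_r -> 'cV[C]_n) : Prop :=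
  r = \rank (dataX x) /\
  exists (U : 'M[C]_(n, r)) (Sigma : 'M[C]_r) (V : 'M[C]_(m, r))
         (v : 'I_r -> 'cV[C]_r),
    let S := dmd_matrix (dataY x) U Sigma V in
    [/\ reduced_svd (dataX x) U Sigma V,
        char_poly S = \prod_(j < r) ('X - (lam j)%:P),
        (forall j, v j != 0 /\ S *m v j = lam j *: v j),
        (forall j, theta j = U *m v j)
      & forall j, a j = (pinv (modes_mx theta) *m x ord0) j 0].

End SDMD.

(* Main.v *)
Require Import Defs.
From mathcomp Require Import all_boot all_order all_algebra.

Set Implicit Arguments.
Unset Strict Implicit.
Unset Printing Implicit Defensive.

Import Order.TTheory GRing.Theory Num.Theory.
Local Open Scope ring_scope.

(** Full rank makes the SVD factor [T = Sigma V^*] an invertible square matrix,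
    so [X = U T] and [S = U^* Y T^-1].  Since the [k]-th columns of [X] and [Y]
    are [x_k] and [x_(k+1)], the column [k] of [S (U^* X) = S T = U^* Y] reads
    [S (U^* x_k) = U^* x_(k+1)]: the compressed snapshots [U^* x_k] are an exact
    orbit of [S] up to and including the last one ([compressed_step]).
    Distinct eigenvalues make the eigenvectors [v_j] a basis
    ([eigenvectors_unit]), so that if
    [U^* x_0 = \sum_j b_j v_j], then
    [U^* x_k = \sum_j lambda_j^k b_j v_j] ([orbit_eigenexpansion]).

    Applying [U] gives the expansion of [U U^* x_k] in the modes
    [theta_j = U v_j].  The matrix [U U^*] is the orthogonal projector on the
    range of [X], that is [X X^+] ([mul_pinv_range]); it fixes
    [x_0, ..., x_(m-1)], and on [x_m] it leaves out exactly [q].  Finally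
    [Theta = U W], with [W] the matrix of the [v_j], has a left inverse, so
    [Theta^+ Theta = 1] ([pinv_mul_linv]) and the amplitudes [Theta^+ x_0] are
    the coefficients [b_j]. *)

(** * Eigenvector expansions *)

Section Eigenvectors.
Variables (F : fieldType) (m : nat) (S : 'M[F]_m).
Variables (lam : 'I_m -> F) (v : 'I_m -> 'cV[F]_m).
Hypothesis Sv : forall j, S *m v j = lam j *: v j.

Lemma mul_cols_mx n (u : 'I_m -> 'cV[F]_n) (c : 'cV[F]_m) :
  (\matrix_(i, j) u j i 0) *m c = \sum_j c j 0 *: u j.
Proof.
apply/colP => i; rewrite mxE summxE; apply: eq_bigr => j _.
by rewrite !mxE mulrC.
Qed.

Lemma orbit_eigenexpansion (y : nat -> 'cV[F]_m) (b : 'I_m -> F) (N : nat) :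
  (forall k, (k < N)%N -> y k.+1 = S *m y k) ->
  y 0%N = \sum_j b j *: v j ->
  forall k, (k <= N)%N -> y k = \sum_j (lam j ^+ k * b j) *: v j.
Proof.
move=> yS y0; elim=> [_|k IHk lt_kN].
  by rewrite y0; apply: eq_bigr => j _; rewrite mul1r.
rewrite yS // IHk ?(ltnW lt_kN) // mulmx_sumr; apply: eq_bigr => j _.
by rewrite -scalemxAr Sv scalerA exprSr mulrAC.
Qed.

(** A relation [\sum_j c_j v_j = 0] says that the zero orbit of [S] has the
    expansion [c], hence [\sum_j lambda_j^k c_j v_j = 0] for every [k].  These
    equations say that the matrix with columns [c_j v_j] is killed by the
    transposed Vandermonde matrix of the eigenvalues, which is invertible. *)
Lemma eigenvectors_unit :
  injective lam -> (forall j, v j != 0) ->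
  \matrix_(i, j) v j i 0 \in unitmx.
Proof.
move=> lam_inj v_neq0; rewrite -unitmx_tr -row_free_unit.
apply/inj_row_free => u uW0.
have rel0 : \sum_j u 0 j *: v j = 0.
  have Wu0 : (\matrix_(i, j) v j i 0) *m u^T = 0.
    by apply: trmx_inj; rewrite trmx_mul trmxK uW0 trmx0.
  by rewrite -[RHS]Wu0 mul_cols_mx; apply: eq_bigr => j _; rewrite mxE.
have relk k : \sum_j (lam j ^+ k * u 0 j) *: v j = 0.
  rewrite -(@orbit_eigenexpansion (fun=> 0) (u 0) k) // => l _.
  by rewrite mulmx0.
pose lamV := \row_j lam j.
have unitV : (Vandermonde m lamV)^T \in unitmx.
  rewrite unitmx_tr unitmxE det_Vandermonde unitfE.
  apply/prodf_neq0 => i _; apply/prodf_neq0 => j lt_ij.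
  by rewrite !mxE subr_eq0 (inj_eq lam_inj) neq_ltn lt_ij orbT.
pose D := \matrix_(i, j) (u 0 j * v j i 0).
have D0 : D = 0.
  apply: (can_inj (mulmxK unitV)); rewrite mul0mx; apply/matrixP => i k.
  transitivity ((\sum_j (lam j ^+ k * u 0 j) *: v j) i 0); last first.
    by rewrite relk !mxE.
  rewrite mxE summxE; apply: eq_bigr => j _; rewrite !mxE.
  by rewrite mulrC mulrA.
apply/rowP => j; rewrite !mxE; apply/eqP/negPn/negP => uj_neq0.
case/negP: (v_neq0 j); apply/eqP/colP => i; rewrite mxE.
move/matrixP/(_ i j)/eqP: D0; rewrite !mxE mulf_eq0 (negPf uj_neq0) /=.
by move/eqP.
Qed.

End Eigenvectors.

(** * Pseudoinverses and the range projector *)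

Section Pseudoinverse.
Local Open Scope sesquilinear_scope.
Variable C : numClosedFieldType.

Lemma pinv_mul_linv n r (A : 'M[C]_(n, r)) (L : 'M[C]_(r, n)) :
  L *m A = 1%:M -> pinv A *m A = 1%:M.
Proof.
move=> LA; have /and4P[/eqP APA _ _ _] := pinvP A.
by rewrite -[LHS]mul1mx -LA -mulmxA (mulmxA A) APA.
Qed.

(** Both sides are the orthogonal projector on the common range of [U * T] and
    [U]: each absorbs the other on the left, and both are Hermitian. *)
Lemma mul_pinv_range n r m (U : 'M[C]_(n, r)) (T : 'M[C]_(r, m))
    (T' : 'M[C]_(m, r)) :
  U^t* *m U = 1%:M -> T *m T' = 1%:M ->
  U *m T *m pinv (U *m T) = U *m U^t*.
Proof.
move=> UU TT'; have /and4P[/eqP XPX _ /eqP QC _] := pinvP (U *m T).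
set Q := _ *m pinv _ in XPX QC *.
have QU : Q *m U = U.
  move: (congr1 (mulmx^~ T') XPX).
  by rewrite /= -!mulmxA TT' mulmx1.
have UUQ : U *m U^t* *m Q = Q.
  by rewrite /Q !mulmxA -(mulmxA U (U^t*)) UU mulmx1.
by clearbody Q; rewrite -QC -UUQ !trmxC_mul trmxCK QC mulmxA QU.
Qed.

End Pseudoinverse.

(** * Dynamic mode decomposition of full-rank data *)

Section FullRank.
Local Open Scope sesquilinear_scope.
Variable C : numClosedFieldType.

Lemma col_mul p n m (A : 'M[C]_(p, n)) (B : 'M[C]_(n, m)) k :
  col k (A *m B) = A *m col k B.
Proof. by rewrite !colE mulmxA. Qed.

Lemma snapE n m (x : 'I_m.+1 -> 'cV[C]_n) k : snap x k = col k (dataX x).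
Proof. by apply/colP => i; rewrite !mxE. Qed.

Lemma reduced_svd_factor n m (X : 'M[C]_(n, m)) (U : 'M[C]_(n, m))
    (Sigma V : 'M[C]_m) :
  reduced_svd X U Sigma V ->
  let T := Sigma *m V^t* in
  [/\ X = U *m T, T *m (V *m invmx Sigma) = 1%:M
    & V *m invmx Sigma *m T = 1%:M].
Proof.
case=> _ VV Sdiag Spos -> T.
have Su : Sigma \in unitmx.
  have [d Sd] := diag_mxP _ Sdiag.
  rewrite unitmxE Sd det_diag unitfE; apply/prodf_neq0 => i _.
  by have := Spos i; rewrite Sd mxE eqxx => /lt0r_neq0.
have TT' : T *m (V *m invmx Sigma) = 1%:M.
  by rewrite /T mulmxA -(mulmxA Sigma) VV mulmx1 mulmxV.
by split=> //; [rewrite /T mulmxA | apply: mulmx1C].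
Qed.

(** This is column [k] of the identity [S (U^* X) = U^* Y], valid because
    [U^* X = Sigma V^*] is inverted on the left by the factor [V Sigma^-1] of
    [S]. *)
Lemma compressed_step n m (x : 'I_m.+1 -> 'cV[C]_n) U Sigma (V : 'M[C]_m)
    (k : 'I_m) :
  reduced_svd (dataX x) U Sigma V ->
  U^t* *m x (lift ord0 k) =
    dmd_matrix (dataY x) U Sigma V *m (U^t* *m snap x k).
Proof.
move=> svdX; have [UU _ _ _ _] := svdX.
have [XT _ T'T] := reduced_svd_factor svdX.
have -> : x (lift ord0 k) = col k (dataY x) by apply/colP => i; rewrite !mxE.
rewrite snapE -!col_mul XT; congr col.
rewrite (mulmxA (U^t*)) UU mul1mx /dmd_matrix -!mulmxA.
by rewrite (mulmxA V) T'T mulmx1.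
Qed.

End FullRank.

Theorem theorem5p4 (R : realType) (n m : nat) (x : 'I_m.+1 -> 'cV[R[i]]_n)
    (lam a : 'I_m -> R[i]) (theta : 'I_m -> 'cV[R[i]]_n) :
  free [seq snap x k | k : 'I_m] ->
  sdmd x lam a theta ->
  injective lam ->
  let c := pinv (dataX x) *m x ord_max in
  let q := x ord_max - dataX x *m c in
  (forall k : 'I_m,
     snap x k = \sum_(j < m) (lam j ^+ k * a j) *: theta j) /\
  x ord_max = \sum_(j < m) (lam j ^+ m * a j) *: theta j + q.
Proof.
move=> _ [_ [U [Sigma [V [v [svdX _ eigv thetaE aE]]]]]] lam_inj c q.
pose S := dmd_matrix (dataY x) U Sigma V.
have Sv j : S *m v j = lam j *: v j by have [] := eigv j.
have [UU _ _ _ _] := svdX.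
have [XT TT' _] := reduced_svd_factor svdX.
pose Uc := map_mx Num.conj U^T.
have UUsnap k : U *m (Uc *m snap x k) = snap x k.
  by rewrite snapE -!col_mul XT (mulmxA Uc) UU mul1mx.
pose W := modes_mx v.
have Wu : W \in unitmx.
  by apply: (eigenvectors_unit Sv) => // j; have [] := eigv j.
have ThetaE : modes_mx theta = U *m W.
  apply/matrixP => i j; rewrite !mxE thetaE mxE.
  by apply: eq_bigr => l _; rewrite mxE.
have pTheta : pinv (U *m W) *m (U *m W) = 1%:M.
  apply: (pinv_mul_linv (L := invmx W *m Uc)).
  by rewrite -mulmxA (mulmxA Uc) UU mul1mx mulVmx.
have y0 : Uc *m x ord0 = \sum_j a j *: v j.
  pose b := invmx W *m (Uc *m x ord0).
  have Wb : Uc *m x ord0 = W *m b by rewrite /b mulmxA mulmxV ?mul1mx.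
  rewrite Wb mul_cols_mx; apply: eq_bigr => j _; congr (_ *: _).
  (* [x_0] is one of the columns of [X] because [j] witnesses [0 < m]. *)
  have x0 : x ord0 = U *m (W *m b).
    have lt0m : (0 < m)%N by apply: leq_ltn_trans (ltn_ord j).
    have <- : snap x (Ordinal lt0m) = x ord0.
      by congr (x _); apply: val_inj.
    rewrite -Wb -[LHS]UUsnap; congr (_ *m (_ *m x _)).
    exact: val_inj.
  by rewrite aE ThetaE x0 (mulmxA U) mulmxA pTheta mul1mx.
have yk : forall k, (k <= m)%N ->
    Uc *m x (inord k) = \sum_j (lam j ^+ k * a j) *: v j.
  apply: (orbit_eigenexpansion Sv (y := fun k => Uc *m x (inord k))).
    move=> k lt_km; pose k' := Ordinal lt_km.
    have := compressed_step k' svdX; rewrite /snap.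
    have -> : lift ord0 k' = inord k.+1 by apply: val_inj; rewrite /= inordK.
    suff -> : widen_ord (leqnSn m) k' = inord k by [].
    by apply: val_inj; rewrite /= inordK // ltnS ltnW.
  by rewrite -y0; congr (_ *m x _); apply: val_inj; rewrite /= inordK.
have Uyk k (le_km : (k <= m)%N) : U *m (Uc *m x (inord k)) =
    \sum_j (lam j ^+ k * a j) *: theta j.
  rewrite yk // mulmx_sumr; apply: eq_bigr => j _.
  by rewrite -scalemxAr thetaE.
split=> [k|].
  have lt_km := ltn_ord k; rewrite -(Uyk k (ltnW lt_km)) -[LHS]UUsnap.
  congr (_ *m (_ *m x _)).
  by apply: val_inj; rewrite /= inordK // ltnS ltnW.
have XXpinv : dataX x *m pinv (dataX x) = U *m Uc.
  by rewrite XT (mul_pinv_range UU TT').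
rewrite -(Uyk m) // /q /c (mulmxA (dataX x)) XXpinv.
have -> : inord m = ord_max :> 'I_m.+1.
  by apply: val_inj; rewrite /= inordK.
by rewrite -mulmxA addrC subrK.
Qed.
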